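(* Let $\varphi\colon\Gamma\to G$ be a homomorphism of groups, and let $\Gamma\xrightarrow{n}H\xrightarrow{f}G$ be a decomposition of $\varphi$ (i.e. $f(n(\gamma))=\varphi(\gamma)$ for all $\gamma\in\Gamma$) with $n$ a normal map. Then there exists a unique normal morphism $\widetilde f\colon H\to N(\varphi)$, from the normal map $n\colon\Gamma\to H$ to the normal map $\widetilde\varphi\colon\Gamma\to N(\varphi)$ (being the identity on $\Gamma$), such that $\widetilde f(n(\gamma))=\widetilde\varphi(\gamma)$ for all $\gamma\in\Gamma$ and $p_\varphi(\widetilde f(h))=f(h)$ for all $h\in H$.
   Context: Notation: $h^g=g^{-1}hg$ in a group; automorphisms of $\Gamma$ act on the right, so in $\mathrm{Aut}(\Gamma)$ the product $\tau\sigma$ means first $\tau$, then $\sigma$; for $\gamma\in\Gamma$, $c_\gamma\in\mathrm{Aut}(\Gamma)$ is $\delta\mapsto\gamma^{-1}\delta\gamma$. A normal map (crossed module) is a group homomorphism $n\colon M\to G$ together with a right action of $G$ on $M$ by automorphisms, $(a,g)\mapsto a^g$ (the normal structure), such that (NM1) $n(a^g)=n(a)^g$ for all $a\in M$, $g\in G$; (NM2) $a^{n(b)}=a^b=b^{-1}ab$ for all $a,b\in M$. A normal morphism from $n_1\colon\Gamma\to G_1$ to $n_2\colon\Gamma\to G_2$ (identity on $\Gamma$) is a homomorphism $\eta\colon G_1\to G_2$ with $\eta(n_1(\gamma))=n_2(\gamma)$ and $\gamma^{g}=\gamma^{\eta(g)}$ for all $\gamma\in\Gamma$, $g\in G_1$.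 $N(\varphi)$ is the subgroup of $\mathrm{Aut}(\Gamma)\times N_G(\varphi(\Gamma))$ consisting of all compatible pairs $(\tau,g)$, i.e. those with $\varphi(\gamma)^g=\varphi(\tau(\gamma))$ for all $\gamma\in\Gamma$. The map $\widetilde\varphi\colon\Gamma\to N(\varphi)$, $\gamma\mapsto(c_\gamma,\varphi(\gamma))$, is a normal map with normal structure $\gamma^{(\tau,g)}=\tau(\gamma)$, and $p_\varphi\colon N(\varphi)\to G$ is $(\tau,g)\mapsto g$. *)

(* Defs.v *)
From HB Require Import structures.
From mathcomp Require Import all_boot.
From mathcomp Require Import boolp classical_sets.

Set Implicit Arguments.
Unset Strict Implicit.
Unset Printing Implicit Defensive.

Local Open Scope group_scope.

(* Groups are arbitrary, possibly infinite: [groupType] of monoid.v, whose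
   [choiceType] part is available on every type through [boolp].
   [x ^ y] is [y^-1 * (x * y)]. *)

Notation "{ 'hom' G -> H }" := (UMagmaMorphism.type G%type H%type)
  (at level 0, G at level 98, H at level 99,
   format "{ 'hom'  G  ->  H }") : type_scope.

Record Aut (Gam : groupType) := MkAut {
  aut_fun :> Gam -> Gam;
  aut_prop : `[< {morph aut_fun : x y / x * y} /\ bijective aut_fun >]
}.

Section AutGroup.
Variable Gam : groupType.

HB.instance Definition _ := [isSub for @aut_fun Gam].
HB.instance Definition _ := [Choice of Aut Gam by <:].

Implicit Types s t u : Aut Gam.

Lemma autM t : {morph t : x y / x * y}.
Proof. by case: t => t /= /asboolP[]. Qed.

Lemma aut1 t : t 1 = 1.
Proof. by apply: (@mulgI _ (t 1)); rewrite -autM !mulg1. Qed.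

HB.instance Definition _ t :=
  isUMagmaMorphism.Build Gam Gam t (aut1 t, autM t).

Lemma aut_bij t : bijective t.
Proof. by case: t => t /= /asboolP[]. Qed.

Lemma aut_ext s t : s =1 t -> s = t.
Proof. by move=> st; apply/val_inj/funext. Qed.

Fact aut_one_prop :
  `[< {morph (@id Gam) : x y / x * y} /\ bijective (@id Gam) >].
Proof. by apply/asboolP; split=> //; exists id. Qed.
Definition aut_one : Aut Gam := MkAut aut_one_prop.

(* Automorphisms act on the right: the product [s * t] is [s] followed
   by [t]. *)
Fact aut_mul_prop s t :
  `[< {morph (t \o s) : x y / x * y} /\ bijective (t \o s) >].
Proof.
apply/asboolP; split; first by move=> x y /=; rewrite !autM.
exact: bij_comp (aut_bij t) (aut_bij s).
Qed.
Definition aut_mul s t : Aut Gam := MkAut (aut_mul_prop s t).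

Fact aut_inv_subproof t : exists u, cancel t u /\ cancel u t.
Proof.
have [g tg gt] := aut_bij t.
have gP : `[< {morph g : x y / x * y} /\ bijective g >].
  apply/asboolP; split; last by exists t.
  by move=> x y; rewrite -{1}[x]gt -{1}[y]gt -autM tg.
by exists (MkAut gP).
Qed.
Definition aut_inv t : Aut Gam := projT1 (cid (aut_inv_subproof t)).

Lemma aut_invK t : cancel t (aut_inv t).
Proof. by rewrite /aut_inv; case: cid => u []. Qed.

Lemma aut_invKV t : cancel (aut_inv t) t.
Proof. by rewrite /aut_inv; case: cid => u []. Qed.

Fact aut_mulA : associative aut_mul.
Proof. by move=> s t u; apply: aut_ext. Qed.
Fact aut_mul1 : left_id aut_one aut_mul.
Proof. by move=> t; apply: aut_ext. Qed.
Fact aut_mulr1 : right_id aut_one aut_mul.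
Proof. by move=> t; apply: aut_ext. Qed.
Fact aut_mulV : left_inverse aut_one aut_inv aut_mul.
Proof. by move=> t; apply: aut_ext => x /=; apply: aut_invKV. Qed.
Fact aut_mulrV : right_inverse aut_one aut_inv aut_mul.
Proof. by move=> t; apply: aut_ext => x /=; apply: aut_invK. Qed.

HB.instance Definition _ :=
  isGroup.Build (Aut Gam) aut_mulA aut_mul1 aut_mulr1 aut_mulV aut_mulrV.

Lemma autmE s t x : (s * t) x = t (s x). Proof. by []. Qed.

Fact inner_prop (c : Gam) :
  `[< {morph (fun d : Gam => d ^ c) : x y / x * y}
      /\ bijective (fun d : Gam => d ^ c) >].
Proof.
apply/asboolP; split; first by move=> x y; rewrite conjMg.
by exists (fun d => d ^ c^-1) => x; rewrite -conjgM (mulgV, mulVg) conjg1.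
Qed.
Definition inner (c : Gam) : Aut Gam := MkAut (inner_prop c).

Lemma innerE c d : inner c d = d ^ c. Proof. by []. Qed.

Lemma inner_conj t c : inner (t c) = inner c ^ t.
Proof.
apply: (@mulgI _ t); rewrite /conjg mulgA mulgV mul1g; apply: aut_ext => x.
by rewrite !autmE !innerE gmulfJ.
Qed.

End AutGroup.

Section Normaliser.
Variables (G : groupType) (A : set G).

Definition normalises : pred G :=
  fun g => `[< [set x ^ g | x in A]%classic = A >].

Fact normalises_closed : group_closed normalises.
Proof.
split.
  apply/asboolP/seteqP; split=> [_ [x Ax <-]|x Ax]; first by rewrite conjg1.
  by exists x; rewrite ?conjg1.
move=> g h /asboolP gA /asboolP hA; apply/asboolP/seteqP; split.
  move=> _ [x Ax <-]; rewrite conjgM.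
  have : A (x ^ g) by rewrite -gA; exists x.
  by rewrite -{1}hA => -[y Ay <-]; rewrite conjgK.
move=> x Ax.
have : A (x ^ h) by rewrite -hA; exists x.
rewrite -{1}gA => -[y Ay yg].
by exists y => //; rewrite conjgM yg conjgK.
Qed.

Record normaliser := MkNormaliser {
  norm_val :> G;
  norm_prop : normalises norm_val
}.

HB.instance Definition _ := [isSub for norm_val].
HB.instance Definition _ := [Choice of normaliser by <:].
HB.instance Definition _ :=
  SubChoice_isSubGroup.Build G normalises normaliser normalises_closed.

End Normaliser.

(* A right action by endomorphisms is automatically by automorphisms, the
   inverse of [nact ^~ g] being [nact ^~ g^-1]. *)
Record normal_map (M G : groupType) := NormalMap {
  nmap :> {hom M -> G};
  nact : M -> G -> M;
  nactM : forall g, {morph nact^~ g : a b / a * b};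
  nact1 : forall a, nact a 1 = a;
  nact_mul : forall a g h, nact a (g * h) = nact (nact a g) h;
  nm1 : forall a g, nmap (nact a g) = nmap a ^ g;
  nm2 : forall a b, nact a (nmap b) = a ^ b
}.

Record normal_morphism (Gam G1 G2 : groupType)
    (n1 : normal_map Gam G1) (n2 : normal_map Gam G2) := NormalMorphism {
  nmor :> {hom G1 -> G2};
  nmorE : forall c, nmor (n1 c) = n2 c;
  nmor_act : forall c g, nact n1 c g = nact n2 c (nmor g)
}.

Section CompatiblePairs.
Variables (Gam G : groupType) (phi : {hom Gam -> G}).

Definition compatible : pred (Aut Gam * normaliser (range phi)) :=
  fun u => `[< forall c, phi c ^ (u.2 : G) = phi (u.1 c) >].

Fact compatible_closed : group_closed compatible.
Proof.
split; first by apply/asboolP => c /=; rewrite conjg1.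
move=> [s g] [t h] /asboolP /= sg /asboolP /= th; apply/asboolP => c /=.
rewrite conjgM sg.
by apply: (conjg_inj (h : G)); rewrite conjgKV th aut_invKV.
Qed.

Record Nphi := MkNphi {
  Nphi_val :> Aut Gam * normaliser (range phi);
  Nphi_prop : compatible Nphi_val
}.

HB.instance Definition _ := [isSub for Nphi_val].
HB.instance Definition _ := [Choice of Nphi by <:].
HB.instance Definition _ :=
  SubChoice_isSubGroup.Build (Aut Gam * normaliser (range phi))%type
    compatible Nphi compatible_closed.

Definition p_phi (u : Nphi) : G := u.2.

Fact p_phi_mul : {morph p_phi : u v / u * v}.
Proof. by []. Qed.
Fact p_phi_one : p_phi 1 = 1.
Proof. by []. Qed.
HB.instance Definition _ := isUMagmaMorphism.Build Nphi G p_phi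
  (p_phi_one, p_phi_mul).

Fact phi_normalises c : normalises (range phi) (phi c).
Proof.
apply/asboolP/seteqP; split=> [_ [_ [d _ <-] <-]|_ [d _ <-]].
  by exists (d ^ c) => //; rewrite gmulfJ.
exists (phi (d ^ c^-1)); first by exists (d ^ c^-1).
by rewrite -gmulfJ -conjgM mulVg conjg1.
Qed.

Fact phi_compatible c : compatible (inner c, MkNormaliser (phi_normalises c)).
Proof. by apply/asboolP => d /=; rewrite gmulfJ. Qed.

Definition tilde_fun (c : Gam) : Nphi := MkNphi (phi_compatible c).

Fact tilde_fun_mul : {morph tilde_fun : c d / c * d}.
Proof.
move=> c d; apply/val_inj; congr pair; last by apply/val_inj; rewrite /= gmulfM.
by apply: aut_ext => x; rewrite /= conjgM.
Qed.
Fact tilde_fun_one : tilde_fun 1 = 1.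
Proof.
apply/val_inj; congr pair; last by apply/val_inj; rewrite /= gmulf1.
by apply: aut_ext => x; rewrite /= conjg1.
Qed.
HB.instance Definition _ := isUMagmaMorphism.Build Gam Nphi tilde_fun
  (tilde_fun_one, tilde_fun_mul).

Definition Nphi_act (c : Gam) (u : Nphi) : Gam := u.1 c.

Fact Nphi_actM u : {morph Nphi_act^~ u : a b / a * b}.
Proof. by move=> a b; apply: autM. Qed.
Fact Nphi_act1 a : Nphi_act a 1 = a.
Proof. by []. Qed.
Fact Nphi_act_mul a u v : Nphi_act a (u * v) = Nphi_act (Nphi_act a u) v.
Proof. by []. Qed.
Fact tilde_nm1 a u : tilde_fun (Nphi_act a u) = tilde_fun a ^ u.
Proof.
case: u => -[t g] /[dup] /asboolP /= tg cu; apply/val_inj; congr pair.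
  exact: inner_conj.
by apply/val_inj; rewrite /= -tg.
Qed.
Fact tilde_nm2 a b : Nphi_act a (tilde_fun b) = a ^ b.
Proof. by []. Qed.

Definition phi_tilde : normal_map Gam Nphi :=
  NormalMap Nphi_actM Nphi_act1 Nphi_act_mul tilde_nm1 tilde_nm2.

End CompatiblePairs.

(* Main.v *)
(** The only candidate for [ft h] is the pair formed by the automorphism
    [c |-> c^h] of [Gam] and [f h]: the first component is forced by
    [nmor_act], the second by [p_phi (ft h) = f h]. The pair is compatible
    because [phi c ^ f h = f (n c ^ h) = f (n (c^h)) = phi (c^h)], by (NM1). *)

From HB Require Import structures.
Require Import Defs.
From mathcomp Require Import all_boot.
From mathcomp Require Import boolp classical_sets.

Set Implicit Arguments.
Unset Strict Implicit.
Unset Printing Implicit Defensive.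

Local Open Scope group_scope.

Lemma hom_ext (G H : groupType) (u v : {hom G -> H}) : u =1 v -> u = v.
Proof.
case: u v => u [[u1] [u2]] [v [[v1] [v2]]] /= /funext uv; subst v.
by rewrite (Prop_irrelevance u1 v1) (Prop_irrelevance u2 v2).
Qed.

(** Uniqueness in [exists!] means Leibniz equality of records. Everything besides the underlying
    function is a proof of a proposition, so proof irrelevance applies. *)
Lemma normal_morphism_ext (Gam G1 G2 : groupType) (n1 : normal_map Gam G1)
    (n2 : normal_map Gam G2) (u v : normal_morphism n1 n2) :
  u =1 v -> u = v.
Proof.
case: u v => u u1 u2 [v v1 v2] /= /hom_ext uv; subst v.
by rewrite (Prop_irrelevance u1 v1) (Prop_irrelevance u2 v2).
Qed.

(** Normalising and compatibility are propositions, so an equation in [Nphi phi] splits into one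
    about actions on [Gam] and one in [G]. *)
Lemma Nphi_ext (Gam G : groupType) (phi : {hom Gam -> G}) (u v : Nphi phi) :
  (forall c, Nphi_act c u = Nphi_act c v) -> p_phi u = p_phi v -> u = v.
Proof.
move: u v => [[s g] sg] [[t h] th] st gh.
by apply/val_inj; congr pair; [apply: aut_ext | apply: val_inj].
Qed.

Section NormalStructure.
Variables (Gam H : groupType) (n : normal_map Gam H).

Fact nact_aut_prop h :
  `[< {morph (nact n)^~ h : x y / x * y} /\ bijective ((nact n)^~ h) >].
Proof.
apply/asboolP; split; first exact: nactM.
by exists ((nact n)^~ h^-1) => c; rewrite -nact_mul (mulgV, mulVg) nact1.
Qed.
Definition nact_aut h : Aut Gam := MkAut (nact_aut_prop h).

Variables (G : groupType) (phi : {hom Gam -> G}) (f : {hom H -> G}).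
Hypothesis fn : forall c, f (n c) = phi c.

Lemma conj_decomposition c h : phi c ^ f h = phi (nact n c h).
Proof. by rewrite -!fn -gmulfJ nm1. Qed.

Fact decomposition_normalises h : normalises (range phi) (f h).
Proof.
apply/asboolP/seteqP; split=> [_ [_ [c _ <-] <-]|_ [c _ <-]].
  by rewrite conj_decomposition; exists (nact n c h).
(* [G] may be infinite, so the reverse inclusion needs its own argument: acting by [h^-1] yields the
   element that [f h] conjugates to [phi c]. *)
exists (phi (nact n c h^-1)); first by exists (nact n c h^-1).
by rewrite conj_decomposition -nact_mul mulVg nact1.
Qed.

Fact decomposition_compatible h :
  compatible (nact_aut h, MkNormaliser (decomposition_normalises h)).
Proof. by apply/asboolP => c; apply: conj_decomposition. Qed.

Definition lift_fun h : Nphi phi := MkNphi (decomposition_compatible h).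

Fact lift_fun1 : lift_fun 1 = 1.
Proof. by apply: Nphi_ext => [c|]; [apply: nact1 | apply: gmulf1]. Qed.

Fact lift_funM : {morph lift_fun : x y / x * y}.
Proof.
by move=> x y; apply: Nphi_ext => [c|]; [apply: nact_mul | apply: gmulfM].
Qed.

HB.instance Definition _ := isUMagmaMorphism.Build H (Nphi phi) lift_fun
  (lift_fun1, lift_funM).

(** By (NM2), [n c] acts on [Gam] as conjugation by [c], which is the first component of
    [phi_tilde phi c]. *)
Fact lift_funE c : lift_fun (n c) = phi_tilde phi c.
Proof. by apply: Nphi_ext => [d|]; [apply: nm2 | apply: fn]. Qed.

(** The actions agree by conversion, since [lift_fun h] carries the action of [h] as its
    automorphism. *)
Definition lift : normal_morphism n (phi_tilde phi) :=
  @NormalMorphism _ _ _ n (phi_tilde phi) lift_fun lift_funE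
    (fun c h => erefl).

End NormalStructure.

Local Close Scope group_scope.

Theorem proposition7p9 (Gam G H : groupType) (phi : {hom Gam -> G})
    (n : normal_map Gam H) (f : {hom H -> G})
    (fn : forall c : Gam, f (n c) = phi c) :
  exists! ft : normal_morphism n (phi_tilde phi),
    (forall c : Gam, ft (n c) = phi_tilde phi c) /\
    (forall h : H, p_phi (ft h) = f h).
Proof.
exists (lift fn); split; first by split=> // c; apply: nmorE.
move=> ft [_ ftf]; apply: normal_morphism_ext => h.
(* The left side of [nmor_act] is, up to conversion, the action of [lift fn h] on [c]. *)
by apply: Nphi_ext => [c|]; [exact: (nmor_act ft c h) | rewrite ftf].
Qed.
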